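(* Let $I_0$ be an interval and let $\{f_k\}_{k\ge0}$ be a $C^1$-uniformly equicontinuous and $C^1$-uniformly bounded sequence of $C^1$ maps $f_k:I_0\to I_0$ with $p=\sup_k\#\mathcal{C}_k<\infty$. Suppose there is $\lambda>0$ such that $$\liminf_{n\to\infty}\frac1n\log|Df^n(x)|>2\lambda$$ for all $x$ in a set $H\subset I_0$. Then there exists $c>0$ such that $$\liminf_{n\to\infty}\frac1n\sum_{i=1}^n r_i(\{f_k\},x)\ge c$$ for Lebesgue almost every $x\in H$.
   Context: $\mathcal{C}_k$ denotes the set of critical points of $f_k$ (possibly empty). $f^i=f_{i-1}\circ\cdots\circ f_1\circ f_0$ for $i\ge1$ and $f^0=\mathrm{id}$. For $i\in\mathbb{N}$ and $x\in I_0$: $T_i(\{f_k\},x)$ is the maximal interval contained in $I_0$ and containing $x$ such that $f^j(T_i(x))\cap\mathcal{C}_j=\emptyset$ for $0\le j<i$; $L_i(x),R_i(x)$ are the connected components of $T_i(x)\setminus\{x\}$; and $r_i(\{f_k\},x)=\min\{|f^i(L_i(x))|,|f^i(R_i(x))|\}$ ($|\cdot|$ = length). The sequence is $C^1$-uniformly equicontinuous if for every $\zeta>0$ there is $\varepsilon>0$ such that $|x-y|<\varepsilon$ implies $|f_k(x)-f_k(y)|<\zeta$ and $|Df_k(x)-Df_k(y)|<\zeta$ for all $k$; it is $C^1$-uniformly bounded if there is $\Gamma>0$ with $|f_k(x)|,|Df_k(x)|\le\Gamma$ for all $x\in I_0$ and all $k$. *)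

(* Defs.v *)
From HB Require Import structures.
From mathcomp Require Import all_boot all_order all_algebra.
From mathcomp Require Import all_classical all_reals all_analysis.
Set Implicit Arguments. Unset Strict Implicit. Unset Printing Implicit Defensive.
Import Order.TTheory GRing.Theory Num.Theory.
Import numFieldNormedType.Exports.
Local Open Scope classical_set_scope.
Local Open Scope ring_scope.

Section Defs.
Variable R : realType.

Definition has_deriv_within (I0 : set R) (g : R -> R) (x d : R) : Prop :=
  (fun y => (g y - g x) / (y - x)) @ within (fun y => I0 y /\ y != x) (nbhs x)
    --> d.

Definition C1_map (I0 : set R) (g Dg : R -> R) : Prop :=
  [/\ forall x, I0 x -> I0 (g x),
      forall x, I0 x -> has_deriv_within I0 g x (Dg x) &
      {within I0, continuous Dg}].

Definition crit (I0 : set R) (Df : nat -> R -> R) (k : nat) : set R := [set x | I0 x /\ Df k x = 0].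

Fixpoint fiter (f : nat -> R -> R) (n : nat) : R -> R :=
  match n with 0 => id | n.+1 => f n \o fiter f n end.

(* Df^n(x), by the chain rule *)
Definition Dfiter (f Df : nat -> R -> R) (n : nat) (x : R) : R :=
  \prod_(j < n) Df j (fiter f j x).

Definition C1_equicont (I0 : set R) (f Df : nat -> R -> R) : Prop :=
  forall zeta : R, 0 < zeta -> exists2 eps : R, 0 < eps &
    forall x y, I0 x -> I0 y -> `|x - y| < eps -> forall k,
      `|f k x - f k y| < zeta /\ `|Df k x - Df k y| < zeta.

Definition C1_bounded (I0 : set R) (f Df : nat -> R -> R) : Prop :=
  exists2 G : R, 0 < G & forall k x, I0 x -> `|f k x| <= G /\ `|Df k x| <= G.

(* T_i(x): the maximal interval contained in I0, containing x, with
   f^j(T) disjoint from C_j for 0 <= j < i (empty if no such interval). *)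
Definition admissible (I0 : set R) (f Df : nat -> R -> R) (i : nat) (x : R) (J : set R) : Prop :=
  [/\ is_interval J, J `<=` I0, J x &
      forall j, (j < i)%N -> forall z, J z -> ~ crit I0 Df j (fiter f j z)].

Definition Tint (I0 : set R) (f Df : nat -> R -> R) (i : nat) (x : R) : set R :=
  \bigcup_(J in admissible I0 f Df i x) J.

Definition Lint (I0 : set R) (f Df : nat -> R -> R) i x : set R := Tint I0 f Df i x `&` [set y | y < x].
Definition Rint (I0 : set R) (f Df : nat -> R -> R) i x : set R := Tint I0 f Df i x `&` [set y | x < y].

(* length of an interval (its diameter; 0 for the empty set) *)
Definition len (A : set R) : \bar R :=
  ereal_sup ([set 0%E] `|` [set (`|y - z|)%:E | y in A & z in A]).

Definition rr (I0 : set R) (f Df : nat -> R -> R) (i : nat) (x : R) : \bar R :=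
  Order.min (len (fiter f i @` Lint I0 f Df i x))
            (len (fiter f i @` Rint I0 f Df i x)).

End Defs.

(* Main.v *)
Require Import Defs.
From HB Require Import structures.
From mathcomp Require Import all_boot all_order all_algebra.
From mathcomp Require Import all_classical all_reals all_analysis.
From mathcomp Require Import measurable_realfun.
From mathcomp Require Import ring lra zify.
Import Order.TTheory GRing.Theory Num.Theory.
Import numFieldNormedType.Exports.
Set Implicit Arguments.
Unset Strict Implicit.
Unset Printing Implicit Defensive.
Local Open Scope classical_set_scope.
Local Open Scope ring_scope.

(** Fix [theta = e^(lambda/3)].  Starting from a short interval, refine it step by
    step into pieces on which [f^i] is injective.  A piece is cut at time [i]
    - at the preimages of the critical points of [f_i], when its image meets them;
    - when its image is longer than [eps], into the points at which the left
      component of [f^i(T_i) \ {f^i x}] is shorter than [delta = eps / G^M], those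
      at which the right one is, and at most [N] pieces with image of length
      [<= delta] made of points with [r_i >= delta].
    Each cut divides a weight among the new pieces so that the total weight stays
    at most 1.  Let [x] be a point with [|Df^n x| >= e^(2 lambda n)] and
    [r_1 + ... + r_n < c n].  Critical cuts cost a factor [G^-q] in the derivative,
    by equicontinuity, so the piece of [x] has undergone at most [n / q] of them;
    after a cut of the second kind the image needs [M] steps to become longer than
    [eps] again, so there are at most [n / M + 1] of these; and only few of them
    happen at times with [r_i >= delta].  With suitable constants the weight of the
    piece is thus at least of order [theta^(-3n) = e^(-lambda n)], while such
    points fill at most a length of order [e^(-2 lambda n)] of any piece, by
    injectivity.  Summing over the pieces, the set of such points has measure
    [O(e^(-lambda n))], and Borel-Cantelli concludes. *)

(** * Derivatives relative to an interval *)

Section C1_functions.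
Context {R : realType}.
Implicit Types (f g Df Dg h : R -> R).

Definition cont_on (I0 : set R) h := forall x, I0 x -> forall e, 0 < e ->
  exists2 r, 0 < r & forall y, I0 y -> `|y - x| < r -> `|h y - h x| < e.

(** Differentiability stated without division, so that [y = x] is allowed and end points of [I0] get
    their one-sided derivative in the same form. *)
Definition deriv_on (I0 : set R) g Dg := forall x, I0 x -> forall e, 0 < e ->
  exists2 r, 0 < r & forall y, I0 y -> `|y - x| < r ->
    `|g y - g x - Dg x * (y - x)| <= e * `|y - x|.

Lemma within_cont_on (I0 : set R) h : {within I0, continuous h} -> cont_on I0 h.
Proof.
move/subspace_continuousP => hc x Ix e e0.
have /cvgrPdist_lt/(_ e e0) := hc x Ix.
rewrite near_withinE => /nbhs_ballP[r /= r0 H].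
exists r => // y Iy yx; rewrite distrC; apply: H => //.
by rewrite /ball /= distrC.
Qed.

Lemma cont_on_within I0 (A : set R) h : A `<=` I0 -> cont_on I0 h ->
  {within A, continuous h}.
Proof.
move=> AI hc; apply/subspace_continuousP => x Ax.
apply/cvgrPdist_lt => e e0; rewrite near_withinE.
have [r r0 H] := hc x (AI _ Ax) e e0.
apply/nbhs_ballP; exists r => //= y; rewrite /ball /= distrC => yx Ay.
by rewrite distrC; apply: H => //; apply: AI.
Qed.

Lemma deriv_on_has_deriv I0 g Dg :
  (forall x, I0 x -> has_deriv_within I0 g x (Dg x)) -> deriv_on I0 g Dg.
Proof.
move=> H x Ix e e0.
have /cvgrPdist_lt/(_ e e0) := H x Ix.
rewrite near_withinE => /nbhs_ballP[r /= r0 {}H].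
exists r => // y Iy yx; have [->|yNx] := eqVneq y x.
  by rewrite !subrr mulr0 subr0 normr0 mulr0.
have /ltW : `|Dg x - (g y - g x) / (y - x)| < e.
  by apply: H => //; rewrite /ball /= distrC.
have yx0 : y - x != 0 by rewrite subr_eq0.
have -> : g y - g x - Dg x * (y - x) =
    - ((Dg x - (g y - g x) / (y - x)) * (y - x)) by field.
by rewrite normrN normrM => ?; rewrite ler_wpM2r.
Qed.

Lemma deriv_on_cont_on I0 g Dg : deriv_on I0 g Dg -> cont_on I0 g.
Proof.
move=> H x Ix e e0; have [r r0 {}H] := H x Ix 1 ltr01.
have D0 : 0 < `|Dg x| + 1 by rewrite ltr_wpDl.
exists (Num.min r (e / (`|Dg x| + 1))); first by rewrite lt_min r0 divr_gt0.
move=> y Iy; rewrite lt_min => /andP[yr ye].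
have := H y Iy yr; rewrite mul1r => Hy.
have -> : g y - g x = (g y - g x - Dg x * (y - x)) + Dg x * (y - x) by ring.
apply: (le_lt_trans (ler_normD _ _)); rewrite normrM.
move: ye; rewrite ltr_pdivlMr // => ye.
apply: le_lt_trans ye; rewrite [leRHS]mulrDr mulr1.
by rewrite [`|y - x| * `|Dg x|]mulrC addrC lerD2l.
Qed.

Lemma deriv_on_is_derive I0 g Dg a b x : `]a, b[%classic `<=` I0 ->
  deriv_on I0 g Dg -> x \in `]a, b[ -> is_derive x 1 g (Dg x).
Proof.
move=> abI H xab.
have Ix : I0 x by apply: abI.
suff C : h^-1 *: (g (h *: 1 + x) - g x) @[h --> 0^'] --> Dg x.
  by apply: DeriveDef; [apply/cvg_ex; exists (Dg x)|apply/cvg_lim].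
apply/cvgrPdist_le => e e0; have [r r0 {}H] := H x Ix e e0.
have /nbhs_ballP[r' /= r'0 xr'] : nbhs x `]a, b[%classic.
  by apply: open_nbhs_nbhs; split => //; exact: interval_open.
rewrite near_withinE; apply/nbhs_ballP.
exists (Num.min r r') => /=; first by rewrite lt_min r0.
move=> t; rewrite /ball /= sub0r normrN lt_min => /andP[tr tr'] t0.
rewrite [_ *: 1]mulr1.
have := H (t + x); rewrite addrK => /(_ _ tr) {}H.
have /H {}H : I0 (t + x).
  by apply/abI/xr'; rewrite /ball /= opprD addrCA subrr addr0 normrN.
have -> : Dg x - t^-1 *: (g (t + x) - g x) =
    - ((g (t + x) - g x - Dg x * t) / t) by rewrite /GRing.scale /=; field.
by rewrite normrN normrM normfV ler_pdivrMr ?normr_gt0.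
Qed.

Lemma deriv_on_comp I0 f Df g Dg : (forall x, I0 x -> I0 (g x)) ->
  deriv_on I0 f Df -> deriv_on I0 g Dg ->
  deriv_on I0 (f \o g) (fun x => Dg x * Df (g x)).
Proof.
move=> gI Hf Hg x Ix e e0.
have gc := deriv_on_cont_on Hg.
have D0 : 0 < 2 * (`|Dg x| + 1).
  by rewrite mulr_gt0 // ltr_wpDl.
have D1 : 0 < 2 * (`|Df (g x)| + 1).
  by rewrite mulr_gt0 // ltr_wpDl.
have [r1 r10 H1] := Hf (g x) (gI _ Ix) (e / (2 * (`|Dg x| + 1)))
  (divr_gt0 e0 D0).
have [r2 r20 H2] := gc x Ix r1 r10.
have [r3 r30 H3] := Hg x Ix (e / (2 * (`|Df (g x)| + 1))) (divr_gt0 e0 D1).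
have [r4 r40 H4] := Hg x Ix 1 ltr01.
exists (Num.min r2 (Num.min r3 r4)); first by rewrite !lt_min r20 r30.
move=> y Iy; rewrite !lt_min => /and3P[y2 y3 y4].
have {}H1 := H1 _ (gI _ Iy) (H2 _ Iy y2).
have {}H3 := H3 _ Iy y3; have {}H4 := H4 _ Iy y4.
rewrite /=.
set A := f (g y) - f (g x) - Df (g x) * (g y - g x) in H1.
set B := g y - g x - Dg x * (y - x) in H3 H4.
have -> : f (g y) - f (g x) - Dg x * Df (g x) * (y - x) = A + Df (g x) * B.
  by rewrite /A /B; ring.
have L : `|g y - g x| <= (`|Dg x| + 1) * `|y - x|.
  have -> : g y - g x = B + Dg x * (y - x) by rewrite /B; ring.
  by apply: (le_trans (ler_normD _ _)); rewrite normrM mulrDl addrC lerD2l.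
apply: (le_trans (ler_normD _ _)); rewrite normrM.
have -> : e * `|y - x| = e / 2 * `|y - x| + e / 2 * `|y - x| by field.
apply: lerD.
  apply: (le_trans H1).
  have -> : e / 2 * `|y - x| =
    e / (2 * (`|Dg x| + 1)) * ((`|Dg x| + 1) * `|y - x|).
    by field; move: D0; rewrite pmulr_rgt0 // => /lt0r_neq0.
  by rewrite ler_pM2l // divr_gt0.
have -> : e / 2 * `|y - x| =
    (`|Df (g x)| + 1) * (e / (2 * (`|Df (g x)| + 1)) * `|y - x|).
  by field; move: D1; rewrite pmulr_rgt0 // => /lt0r_neq0.
by rewrite ler_pM // lerDl.
Qed.

Lemma cont_on_comp I0 h g : (forall x, I0 x -> I0 (g x)) ->
  cont_on I0 h -> cont_on I0 g -> cont_on I0 (h \o g).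
Proof.
move=> gI hc gc x Ix e e0.
have [r r0 Hr] := hc (g x) (gI _ Ix) e e0.
have [r' r'0 Hr'] := gc x Ix r r0.
by exists r' => // y Iy yx; apply: Hr; [apply: gI|apply: Hr'].
Qed.

Lemma cont_onM I0 h g : cont_on I0 h -> cont_on I0 g ->
  cont_on I0 (fun x => h x * g x).
Proof.
move=> hc gc; apply: within_cont_on => x.
by apply: (@continuousM _ (subspace I0));
  [exact: (cont_on_within (@subset_refl _ I0) hc)|
   exact: (cont_on_within (@subset_refl _ I0) gc)].
Qed.

Section one_function.
Variables (I0 : set R) (g Dg : R -> R).
Hypotheses (itvI0 : is_interval I0) (dg : deriv_on I0 g Dg)
  (cDg : cont_on I0 Dg).

Lemma segment_sub a b : I0 a -> I0 b -> `[a, b]%classic `<=` I0.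
Proof.
by move=> Ia Ib x /=; rewrite in_itv /= => xab; apply: itvI0 xab.
Qed.

Lemma oo_segment_sub a b : I0 a -> I0 b -> `]a, b[%classic `<=` I0.
Proof.
move=> Ia Ib; apply: subset_trans (segment_sub Ia Ib).
exact: subset_itv_oo_cc.
Qed.

Lemma deriv_on_MVT a b : I0 a -> I0 b -> a < b ->
  exists2 c, c \in `]a, b[ & g b - g a = Dg c * (b - a).
Proof.
move=> Ia Ib ab; apply: MVT => //.
  by move=> x; apply: deriv_on_is_derive dg; apply: oo_segment_sub.
by apply: cont_on_within (deriv_on_cont_on dg); apply: segment_sub.
Qed.

Lemma deriv_on_lipschitz (G : R) : (forall x, I0 x -> `|Dg x| <= G) ->
  forall a b, I0 a -> I0 b -> `|g a - g b| <= G * `|a - b|.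
Proof.
move=> DG a b; wlog ab : a b / a < b => [W|] Ia Ib.
  have [|ba|->] := ltgtP a b; first by move/W; apply.
    by rewrite distrC [`|a - b|]distrC; apply: W.
  by rewrite !subrr normr0 mulr0.
have [c cab E] := deriv_on_MVT Ia Ib ab.
rewrite distrC [`|a - b|]distrC E normrM ler_wpM2r //; apply: DG.
exact: (oo_segment_sub Ia Ib).
Qed.

(** By the intermediate value theorem, a value of [Dg] of sign opposite to [Dg a] would force a zero
    in between. If [b < a] the segment is empty. *)
Lemma nonvanishing_sign a b : I0 a -> I0 b ->
  (forall x, x \in `[a, b] -> Dg x != 0) ->
  (forall x, x \in `[a, b] -> 0 < Dg x) \/
  (forall x, x \in `[a, b] -> Dg x < 0).
Proof.
move=> Ia Ib D0; have [ab|ba] := leP a b; last first.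
  by left => x; rewrite in_itv /= => /andP[/le_trans/[apply]]; rewrite leNgt ba.
have aab : a \in `[a, b] by rewrite in_itv /= lexx.
have aux x : x \in `[a, b] -> 0 <= Dg a * Dg x.
  move=> xab; rewrite leNgt; apply/negP => neg.
  have xab' : a <= x <= b by rewrite in_itv /= in xab.
  have /andP[ax xb] := xab'.
  have [||z zax Dz] := @IVT R Dg a x 0 ax _ _.
  - apply: cont_on_within cDg; apply: segment_sub => //.
    exact: (segment_sub Ia Ib).
  - have := D0 a aab; rewrite neq_lt => /orP[Da|Da].
      by rewrite ge_min le_max (ltW Da) /=; move: neg; rewrite nmulr_rlt0 //
        => /ltW ->; rewrite orbT.
    rewrite ge_min le_max (ltW Da) /=; move: neg; rewrite pmulr_rlt0 //.
    by move=> /ltW ->; rewrite orbT.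
  have : z \in `[a, b].
    move: zax; rewrite !in_itv /= => /andP[-> zx]; exact: le_trans xb.
  by move/D0; rewrite Dz eqxx.
have := D0 a aab; rewrite neq_lt => /orP[Da|Da]; [right|left] => x xab.
  by rewrite lt_neqAle D0 //= -(nmulr_rge0 _ Da) aux.
by rewrite lt_neqAle eq_sym D0 //= -(pmulr_rge0 _ Da) aux.
Qed.

Lemma nonvanishing_monotone a c : I0 a -> I0 c ->
  (forall x, x \in `[a, c] -> Dg x != 0) ->
  (forall x y, a <= x -> x < y -> y <= c -> g x < g y) \/
  (forall x y, a <= x -> x < y -> y <= c -> g y < g x).
Proof.
move=> Ia Ic D0.
have aux x y : a <= x -> x < y -> y <= c ->
    exists2 z, z \in `[a, c] & g y - g x = Dg z * (y - x).
  move=> ax xy yc; have [||z] := @deriv_on_MVT x y _ _ xy.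
  - by apply: itvI0 Ia Ic _ _; rewrite ax (le_trans (ltW xy)).
  - by apply: itvI0 Ia Ic _ _; rewrite yc (le_trans ax (ltW xy)).
  rewrite in_itv /= => /andP[xz zy] E; exists z => //.
  by rewrite in_itv /= (le_trans ax (ltW xz)) (le_trans (ltW zy)).
have [Dp|Dn] := nonvanishing_sign Ia Ic D0; [left|right] => x y ax xy yc;
  have [z zac E] := aux x y ax xy yc.
  by rewrite -subr_gt0 E mulr_gt0 ?subr_gt0 // Dp.
by rewrite -subr_lt0 E nmulr_rlt0 ?subr_gt0 // Dn.
Qed.

Notation mu := (@lebesgue_measure R).

(** Markov's inequality for [|Dg|]: since [Dg] has constant sign, the fundamental theorem of
    calculus gives its integral as [|g b - g a|]. *)
Lemma measure_large_deriv a b (D : R) : I0 a -> I0 b -> a < b -> 0 < D ->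
  (forall x, x \in `[a, b] -> Dg x != 0) ->
  measurable (`[a, b] `&` [set x | D <= `|Dg x|]) /\
  (mu (`[a, b] `&` [set x | (D <= `|Dg x|)%R]) <= (`|g b - g a| / D)%:E)%E.
Proof.
move=> Ia Ib ab D0 nz.
have cD : {within `[a, b], continuous Dg}.
  by apply: cont_on_within cDg; apply: segment_sub.
have mD : measurable_fun `[a, b] Dg by apply: subspace_continuous_measurable_fun.
have mE : measurable_fun `[a, b] (EFin \o Dg) by apply/measurable_EFinP.
have dab : derivable_oo_LRcontinuous g a b.
  have /continuous_within_itvP -/(_ ab)[_ ga gb] : {within `[a, b], continuous g}.
    by apply: cont_on_within (deriv_on_cont_on dg); apply: segment_sub.
  split=> // x /(deriv_on_is_derive (oo_segment_sub Ia Ib) dg) ?; exact: ex_derive.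
have D' : {in `]a, b[, derive1 g =1 Dg}.
  move=> x /(deriv_on_is_derive (oo_segment_sub Ia Ib) dg) ?.
  by rewrite derive1E derive_val.
have FTC := continuous_FTC2 ab cD dab D'.
have eqS : `[a, b] `&` [set x | D <= `|Dg x|] =
    `[a, b] `&` [set x | (D%:E <= `|(EFin \o Dg) x|)%E].
  by apply/seteqP; split => x [/= ? ?]; split.
split.
  rewrite eqS; apply: emeasurable_fun_c_infty => //; exact: measurableT_comp.
have := le_integral_abse mu (measurable_itv _) mE D0.
rewrite -eqS => M.
have I : (\int[mu]_(x in `[a, b]) `|(EFin \o Dg) x| = `|g b - g a|%:E)%E.
  have [s|s] := nonvanishing_sign Ia Ib nz.
    transitivity (\int[mu]_(x in `[a, b]) (Dg x)%:E)%E.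
      by apply: eq_integral => x; rewrite inE /= => /s ?; rewrite ger0_norm ?ltW.
    rewrite FTC -EFinB ger0_norm // subr_ge0.
    have [z /subset_itv_oo_cc/s z0 E] := deriv_on_MVT Ia Ib ab.
    by rewrite -subr_ge0 E mulr_ge0 ?subr_ge0 // ltW.
  transitivity (\int[mu]_(x in `[a, b]) ((-1)%:E * (Dg x)%:E))%E.
    apply: eq_integral => x; rewrite inE /= => /s ?.
    by rewrite ltr0_norm // -EFinM mulN1r.
  rewrite integralZl //; last first.
    apply: continuous_compact_integrable => //; exact: segment_compact.
  rewrite FTC -EFinB -EFinM mulN1r ler0_norm // subr_le0.
  have [z /subset_itv_oo_cc/s z0 E] := deriv_on_MVT Ia Ib ab.
  by rewrite -subr_le0 E mulr_le0_ge0 ?subr_ge0 // ltW.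
rewrite I in M.
by rewrite EFinM lee_pdivlMr // muleC.
Qed.

End one_function.
End C1_functions.

(** * Outer bounds on Lebesgue measure *)

Section covered.
Context {R : realType}.
Notation mu := (@lebesgue_measure R).

(** An upper bound on outer Lebesgue measure; asking only for a measurable superset avoids
    measurability proofs for sets defined through [rr]. *)
Definition covered (E : set R) (v : R) := exists B : set R,
  [/\ measurable B, E `<=` B & (mu B <= v%:E)%E].

Lemma covered_sub (E F : set R) (v w : R) : E `<=` F -> v <= w ->
  covered F v -> covered E w.
Proof.
move=> EF vw [B [mB FB Bv]]; exists B; split => //.
  exact: subset_trans FB.
by apply: le_trans Bv _; rewrite lee_fin.
Qed.

Lemma covered0 : covered set0 0.
Proof. by exists set0; split => //; rewrite measure0. Qed.

Lemma coveredU (E F : set R) (v w : R) :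
  covered E v -> covered F w -> covered (E `|` F) (v + w).
Proof.
move=> [B [mB EB Bv]] [C [mC FC Cw]]; exists (B `|` C); split.
- exact: measurableU.
- exact: setUSS.
- by rewrite EFinD; apply: (le_trans (measureU2 mu mB mC)); exact: leeD.
Qed.

Lemma covered_bigcup n (E : nat -> set R) (v : R) :
  (forall j, (j < n)%N -> covered (E j) v) ->
  covered [set x | exists2 j, (j < n)%N & E j x] (v *+ n).
Proof.
elim: n => [|n IH] H.
  by apply: covered_sub covered0 => // x [].
rewrite mulrSr; apply: covered_sub (lexx _) (coveredU (IH _) (H n (leqnn _))).
  move=> x [j]; rewrite ltnS leq_eqVlt => /orP[/eqP->|jn] Ex; first by right.
  by left; exists j.
by move=> j jn; apply: H; rewrite ltnS ltnW.
Qed.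

Lemma covered_segment (a b v : R) : 0 <= v -> b - a <= v ->
  covered `[a, b] v.
Proof.
move=> v0 abv; exists `[a, b]%classic; split => //.
rewrite lebesgue_measure_itv /= lte_fin.
by case: ifP => _; rewrite -?EFinB lee_fin.
Qed.

(** The bounded interval [K] is exhausted by a segment with end points in [K], chosen within
    [eta / 2] of its infimum and supremum; the two remaining ends cost [eta]. *)
Lemma covered_itv_sub (K : set R) (P : set R) (d eta w : R) : is_interval K ->
  (forall x y, K x -> K y -> `|x - y| <= d) -> 0 < eta -> 0 <= w ->
  (forall a b, K a -> K b -> a < b -> covered (`[a, b] `&` P) w) ->
  covered (K `&` P) (w + eta).
Proof.
move=> iK Kd e0 w0 H.
have we : 0 <= w + eta by rewrite addr_ge0 // ltW.
have [[x0 Kx0]|K0] := pselect (exists x, K x); last first.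
  by apply: covered_sub we covered0 => x [Kx _]; apply: K0; exists x.
have lbK y : K y -> x0 - d <= y.
  by move=> Ky; rewrite lerBlDr -lerBlDl (le_trans (ler_norm _)) ?Kd.
have ubK y : K y -> y <= x0 + d.
  by move=> Ky; rewrite -lerBlDl (le_trans (ler_norm _)) ?Kd.
have hi : has_inf K by split; [exists x0|exists (x0 - d) => y /lbK].
have hs : has_sup K by split; [exists x0|exists (x0 + d) => y /ubK].
have e2 : 0 < eta / 2 by rewrite divr_gt0.
have [a Ka ai] := inf_adherent e2 hi.
have [b Kb bs] := sup_adherent e2 hs.
have infK y : K y -> inf K <= y by move=> Ky; apply: ge_inf => //; case: hi.
have supK y : K y -> y <= sup K by move=> Ky; apply: ub_le_sup => //; case: hs.
(* If the chosen points come in the wrong order, [K] itself is shorter than [eta]. *)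
have [ab|ba] := ltP a b; last first.
  apply: covered_sub (lexx _) (@covered_segment (inf K) (sup K) _ we _).
    by move=> x [Kx _] /=; rewrite in_itv /= infK // supK.
  lra.
have C1 := covered_segment (ltW e2) (_ : a - inf K <= eta / 2).
have C2 := covered_segment (ltW e2) (_ : sup K - b <= eta / 2).
apply: covered_sub _ _ (coveredU (H a b Ka Kb ab) (coveredU (C1 _) (C2 _))).
- move=> x [Kx Px]; have [xa|ax] := leP x a.
    by right; left; rewrite /= in_itv /= infK.
  have [bx|xb] := leP b x.
    by right; right; rewrite /= in_itv /= bx supK.
  by left; split => //; rewrite /= in_itv /= !ltW.
- lra.
- lra.
- lra.
Qed.

(** The segments inside [K] give [W / D]; the second [W / D] is the price of the two ends of [K]. *)
Lemma covered_large_deriv (I0 K : set R) (g Dg : R -> R) (d W D : R) :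
  is_interval I0 -> deriv_on I0 g Dg -> cont_on I0 Dg ->
  is_interval K -> K `<=` I0 -> (forall x y, K x -> K y -> `|x - y| <= d) ->
  (forall x, K x -> Dg x != 0) ->
  0 < W -> (forall x y, K x -> K y -> `|g x - g y| <= W) -> 0 < D ->
  covered (K `&` [set x | D <= `|Dg x|]) (2 * W / D).
Proof.
move=> iI dg cg iK KI Kd nz W0 gW D0.
have -> : 2 * W / D = W / D + W / D by field; rewrite lt0r_neq0.
have WD : 0 < W / D by rewrite divr_gt0.
apply: (covered_itv_sub iK Kd) => //; first exact: ltW.
move=> a b Ka Kb ab.
have [|mB Bv] := measure_large_deriv iI dg cg (KI _ Ka) (KI _ Kb) ab D0.
  by move=> x xab; apply/nz/(segment_sub iK Ka Kb).
exists (`[a, b] `&` [set x | D <= `|Dg x|]); split => //.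
apply: le_trans Bv _; rewrite lee_fin ler_wpM2r ?invr_ge0 ?(ltW D0) //.
exact: gW.
Qed.

(** The first Borel-Cantelli lemma, applied to measurable covers whose measures are dominated by a
    geometric series. *)
Lemma ae_eventually_notin (B : nat -> set R) (C rho : R) : 0 <= rho < 1 ->
  (forall n, covered (B n) (C * rho ^+ n)) ->
  {ae mu, forall x, exists N, forall n, (N <= n)%N -> ~ B n x}.
Proof.
move=> /andP[rho0 rho1] /choice[F HF].
exists (lim_sup_set F); split.
- apply: bigcap_measurable => [|n _]; first by exists 0%N.
  by apply: bigcup_measurable => k _; case: (HF k).
- apply: lim_sup_set_cvg0; first by move=> k; case: (HF k).
  apply: (@le_lt_trans _ _ (\sum_(n <oo) (C * rho ^+ n)%:E)%E).
    by apply: lee_nneseries => // n _; case: (HF n).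
  have cv : cvgn (series (geometric C rho)).
    by apply: is_cvg_geometric_series; rewrite ger0_norm.
  rewrite (_ : (fun _ => _) = EFin \o series (geometric C rho)).
    by rewrite EFin_lim // ltry.
  by apply/funext => n /=; rewrite /series /= sumEFin.
- move=> x /= nx n _; apply: contrapT => h; apply: nx; exists n => m nm Bm.
  by apply: h; exists m => //; case: (HF m) => _ /(_ _ Bm).
Qed.

End covered.

(** * Branches of the iterates *)

Section len.
Context {R : realType}.
Implicit Types A B : set R.

Lemma len_ge0 A : (0 <= len A)%E.
Proof. by apply: ereal_sup_ubound; left. Qed.

Lemma dist_le_len A y z : A y -> A z -> (`|y - z|%:E <= len A)%E.
Proof. by move=> Ay Az; apply: ereal_sup_ubound; right; exists y => //; exists z. Qed.

Lemma le_len A B : A `<=` B -> (len A <= len B)%E.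
Proof.
move=> AB; apply: ereal_sup_le => _ [->|[y Ay [z Az <-]]]; first by left.
by right; exists y; [exact: AB|exists z; [exact: AB|]].
Qed.

Lemma is_intervalU A B x : is_interval A -> is_interval B -> A x -> B x ->
  is_interval (A `|` B).
Proof.
move=> iA iB Ax Bx a b + + z /andP[az zb].
have [zx|xz] := leP z x.
  case=> [Aa _|Ba _]; [left; apply: iA Aa Ax _ _|right; apply: iB Ba Bx _ _];
    by rewrite az.
move=> _ [Ab|Bb]; [left; apply: iA Ax Ab _ _|right; apply: iB Bx Bb _ _];
  by rewrite zb ltW.
Qed.

(** The sides [Lint] and [Rint] omit their base point, so bounds on their images reach it only by
    continuity. *)
Lemma dist_le_of_interior (I0 : set R) (h : R -> R) (a b d : R) :
  is_interval I0 -> cont_on I0 h -> I0 a -> I0 b -> a < b ->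
  (forall x y, a < x < b -> a < y < b -> `|h x - h y| <= d) -> `|h a - h b| <= d.
Proof.
move=> iI hc Ia Ib ab H; apply/ler_addgt0Pr => e e0.
have e2 : 0 < e / 2 by rewrite divr_gt0.
have [r r0 Hr] := hc a Ia _ e2; have [t t0 Ht] := hc b Ib _ e2.
pose s := Num.min r (Num.min t (b - a)) / 3.
have s0 : 0 < s by rewrite divr_gt0 // !lt_min r0 t0 subr_gt0.
have m1 : s * 3 <= r by rewrite divfK // ge_min lexx.
have m2 : s * 3 <= t by rewrite divfK // !ge_min lexx orbT.
have m3 : s * 3 <= b - a by rewrite divfK // !ge_min lexx !orbT.
have Ix : I0 (a + s) by apply: iI Ia Ib _ _; apply/andP; split; lra.
have Iy : I0 (b - s) by apply: iI Ia Ib _ _; apply/andP; split; lra.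
have := Hr _ Ix; rewrite addrAC subrr add0r gtr0_norm // => /(_ ltac:(lra)) Hr'.
have := Ht _ Iy; rewrite addrAC subrr add0r normrN gtr0_norm //.
move=> /(_ ltac:(lra)) Ht'.
have Hm := H (a + s) (b - s) ltac:(apply/andP; split; lra)
  ltac:(apply/andP; split; lra).
have -> : h a - h b = - (h (a + s) - h a) + (h (a + s) - h (b - s))
  + (h (b - s) - h b) by ring.
apply: le_trans (ler_normD _ _) _; apply: le_trans (lerD (ler_normD _ _) (lexx _)) _.
by rewrite normrN; lra.
Qed.

End len.

Lemma count_lt_mono {R : realType} (s : seq R) (a b : R) : a <= b ->
  (count (fun c => c < a)%R s <= count (fun c => c < b)%R s)%N.
Proof. by move=> ab; apply: sub_count => c /= ca; apply: lt_le_trans ab. Qed.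

Lemma count_lt_strict {R : realType} (s : seq R) (a b c : R) : c \in s ->
  a <= c -> c < b ->
  (count (fun c => c < a)%R s < count (fun c => c < b)%R s)%N.
Proof.
move=> + ac cb; elim: s => //= x s IH; rewrite inE => /predU1P[<-|cs].
  by rewrite cb ltNge ac /= add0n ltnS count_lt_mono // (le_trans ac (ltW cb)).
have := IH cs; have [xa|_] := ltP x a; last first.
  by move=> /leq_trans; apply; exact: leq_addl.
by rewrite (lt_trans xa (le_lt_trans ac cb)).
Qed.

Section iterates.
Context {R : realType}.
Variables (I0 : set R) (f Df : nat -> R -> R).
Hypotheses (itvI0 : is_interval I0)
  (fI0 : forall k x, I0 x -> I0 (f k x))
  (df : forall k, deriv_on I0 (f k) (Df k))
  (cDf : forall k, cont_on I0 (Df k)).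

Lemma fiter_I0 n x : I0 x -> I0 (fiter f n x).
Proof. by move=> Ix; elim: n => //= n; apply: fI0. Qed.

Lemma DfiterS n x : Dfiter f Df n.+1 x = Dfiter f Df n x * Df n (fiter f n x).
Proof. by rewrite /Dfiter big_ord_recr. Qed.

Lemma fiter_deriv n : deriv_on I0 (fiter f n) (Dfiter f Df n).
Proof.
elim: n => [|n IH].
  move=> x Ix e e0; exists 1 => // y Iy _.
  by rewrite /Dfiter big_ord0 /= mul1r subrr normr0 mulr_ge0 // ltW.
rewrite (_ : Dfiter _ _ _ = fun x => Dfiter f Df n x * Df n (fiter f n x)).
  by apply: deriv_on_comp => // x; exact: fiter_I0.
by apply/funext => x; rewrite DfiterS.
Qed.

Lemma fiter_cont n : cont_on I0 (fiter f n).
Proof. exact: deriv_on_cont_on (@fiter_deriv n). Qed.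

Lemma Dfiter_cont n : cont_on I0 (Dfiter f Df n).
Proof.
elim: n => [|n IH].
  by move=> x Ix e e0; exists 1 => // y _ _; rewrite /Dfiter !big_ord0 subrr normr0.
rewrite (_ : Dfiter _ _ _ = fun x => Dfiter f Df n x * (Df n \o fiter f n) x).
  apply: cont_onM => //; apply: cont_on_comp => //; last exact: fiter_cont.
  by move=> x; exact: fiter_I0.
by apply/funext => x; rewrite DfiterS.
Qed.

Definition branch i (K : set R) := [/\ is_interval K, K `<=` I0 &
  forall j, (j < i)%N -> forall z, K z -> Df j (fiter f j z) != 0].

Lemma branch_Dfiter i K x : branch i K -> K x -> Dfiter f Df i x != 0.
Proof. by move=> [_ _ nc] Kx; apply/prodf_neq0 => j _; apply: nc. Qed.

Lemma branch_monotone i K a c : branch i K -> K a -> K c ->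
  let g := fiter f i in
  (forall x y, a <= x -> x < y -> y <= c -> g x < g y) \/
  (forall x y, a <= x -> x < y -> y <= c -> g y < g x).
Proof.
move=> bK Ka Kc /=; have [iK KI _] := bK.
apply: (nonvanishing_monotone itvI0 (@fiter_deriv i) (@Dfiter_cont i));
  try exact: KI.
by move=> x xac; apply: branch_Dfiter bK _; exact: (segment_sub iK Ka Kc).
Qed.

Lemma branch_interval i K J : branch i K -> is_interval J ->
  is_interval (K `&` fiter f i @^-1` J).
Proof.
move=> bK iJ x y [Kx Jx] [Ky Jy] z /andP[xz zy].
have [iK _ _] := bK.
have Kz : K z by apply: iK Kx Ky _ _; rewrite xz.
split => //=.
move: xz; rewrite le_eqVlt => /predU1P[<-//|xz].
move: zy; rewrite le_eqVlt => /predU1P[->//|zy].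
have [m|m] := branch_monotone bK Kx Ky.
  by apply: iJ Jx Jy _ _; rewrite !ltW // m // ltW.
by apply: iJ Jy Jx _ _; rewrite !ltW // m // ltW.
Qed.

(** The union of [K] with an interval admissible for [x] is again an interval, as both contain [x],
    and it is admissible for [y]. Hence T_i is constant on a branch. *)
Lemma branch_Tint i K x y : branch i K -> K x -> K y ->
  Tint I0 f Df i x `<=` Tint I0 f Df i y.
Proof.
move=> [iK KI nc] Kx Ky z [J [iJ JI Jx ncJ] Jz].
exists (J `|` K); last by left.
split; [exact: is_intervalU Jx Kx|by move=> w []; [exact: JI|exact: KI]|by right|].
by move=> j ji w [/ncJ|Kw [_]]; [exact|apply/eqP/nc].
Qed.

Lemma branch_sub_Tint i K x : branch i K -> K x -> K `<=` Tint I0 f Df i x.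
Proof.
move=> [iK KI nc] Kx z Kz; exists K => //; split => // j ji w Kw [_].
exact/eqP/nc.
Qed.

Lemma branch_Lint i K x y : branch i K -> K x -> K y -> x <= y ->
  Lint I0 f Df i x `<=` Lint I0 f Df i y.
Proof.
move=> bK Kx Ky xy z [/(branch_Tint bK Kx Ky) Tz /= zx]; split => //=.
exact: lt_le_trans zx xy.
Qed.

Lemma branch_Rint i K x y : branch i K -> K x -> K y -> x <= y ->
  Defs.Rint I0 f Df i y `<=` Defs.Rint I0 f Df i x.
Proof.
move=> bK Kx Ky xy z [/(branch_Tint bK Ky Kx) Tz /= zx]; split => //=.
exact: le_lt_trans xy zx.
Qed.

(** * Points of a branch sorted by the lengths of the two sides of T_i *)

Section short_sides.
Variables (i : nat) (K : set R) (d : R).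
Hypothesis bK : branch i K.

Let lL x := len (fiter f i @` Lint I0 f Df i x).
Let lR x := len (fiter f i @` Defs.Rint I0 f Df i x).

Definition short_left := K `&` [set x | (lL x < d%:E)%E].
Definition short_right := K `&` [set x | (lR x < d%:E)%E].
Definition long_sides := K `&` [set x | (d%:E <= rr I0 f Df i x)%E].

Lemma lL_mono x y : K x -> K y -> x <= y -> (lL x <= lL y)%E.
Proof.
by move=> Kx Ky xy; apply/le_len/image_subset; apply: branch_Lint bK _ _ _.
Qed.

Lemma lR_mono x y : K x -> K y -> x <= y -> (lR y <= lR x)%E.
Proof.
by move=> Kx Ky xy; apply/le_len/image_subset; apply: branch_Rint bK _ _ _.
Qed.

Lemma short_left_interval : is_interval short_left.
Proof.
have [iK _ _] := bK.
move=> x y [Kx _] [Ky ly] z xzy; have Kz := iK _ _ Kx Ky _ xzy.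
split => //=; apply: le_lt_trans ly; apply: lL_mono => //.
by case/andP: xzy.
Qed.

Lemma short_right_interval : is_interval short_right.
Proof.
have [iK _ _] := bK.
move=> x y [Kx lx] [Ky _] z xzy; have Kz := iK _ _ Kx Ky _ xzy.
split => //=; apply: le_lt_trans lx; apply: lR_mono => //.
by case/andP: xzy.
Qed.

Lemma long_sides_interval : is_interval long_sides.
Proof.
have [iK _ _] := bK.
move=> x y [Kx lx] [Ky ly] z xzy; have Kz := iK _ _ Kx Ky _ xzy.
split => //=; move: lx ly => /=; rewrite /rr !le_min => /andP[lx _] /andP[_ ly].
case/andP: xzy => xz zy.
by rewrite (le_trans lx (lL_mono _ _ xz)) // (le_trans ly (lR_mono _ _ zy)).
Qed.

(** For [x < y] everything strictly between them lies in the left side at [y], whose image is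
    shorter than [d]; continuity adds the end points. *)
Lemma short_left_diam x y : short_left x -> short_left y ->
  `|fiter f i x - fiter f i y| <= d.
Proof.
have [iK KI _] := bK.
wlog xy : x y / x < y => [W|] [Kx lx] [Ky ly].
  have [|yx|->] := ltgtP x y; first by move/W; apply.
    by rewrite distrC; apply: W.
  by rewrite subrr normr0 -lee_fin (le_trans _ (ltW ly)) ?len_ge0.
apply: (dist_le_of_interior itvI0 (@fiter_cont i)) xy _; try exact: KI.
have sub w : x < w < y -> Lint I0 f Df i y w.
  move=> /andP[xw wy]; split => //; apply: (branch_sub_Tint bK) => //.
  by apply: iK Kx Ky _ _; rewrite !ltW.
move=> u v /sub Lu /sub Lv; rewrite -lee_fin; apply: le_trans (ltW ly).
by apply: dist_le_len; [exists u|exists v].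
Qed.

Lemma short_right_diam x y : short_right x -> short_right y ->
  `|fiter f i x - fiter f i y| <= d.
Proof.
have [iK KI _] := bK.
wlog xy : x y / x < y => [W|] [Kx lx] [Ky ly].
  have [|yx|->] := ltgtP x y; first by move/W; apply.
    by rewrite distrC; apply: W.
  by rewrite subrr normr0 -lee_fin (le_trans _ (ltW ly)) ?len_ge0.
apply: (dist_le_of_interior itvI0 (@fiter_cont i)) xy _; try exact: KI.
have sub w : x < w < y -> Defs.Rint I0 f Df i x w.
  move=> /andP[xw wy]; split => //; apply: (branch_sub_Tint bK) => //.
  by apply: iK Kx Ky _ _; rewrite !ltW.
move=> u v /sub Lu /sub Lv; rewrite -lee_fin; apply: le_trans (ltW lx).
by apply: dist_le_len; [exists u|exists v].
Qed.

Lemma short_or_long x : K x -> short_left x \/ short_right x \/ long_sides x.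
Proof.
move=> Kx; have [l|l] := ltP (lL x) d%:E; first by left.
have [r|r] := ltP (lR x) d%:E; first by right; left.
by right; right; split => //=; rewrite /rr le_min l.
Qed.

End short_sides.

End iterates.

(** * Refinement into weighted pieces *)

Section pieces.
Context {R : realType}.
Variables (I0 : set R) (f Df : nat -> R -> R).
Hypotheses (itvI0 : is_interval I0)
  (fI0 : forall k x, I0 x -> I0 (f k x))
  (df : forall k, deriv_on I0 (f k) (Df k))
  (cDf : forall k, cont_on I0 (Df k)).
Variables (G eps : R) (q M p N : nat).
Hypotheses (G1 : 1 < G) (eps0 : 0 < eps).
Let delta : R := eps / G ^+ M.
Hypotheses (fG : forall k x, I0 x -> `|f k x| <= G)
  (DfG : forall k x, I0 x -> `|Df k x| <= G)
  (crit_small : forall k x y, I0 x -> I0 y -> `|x - y| <= eps ->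
     Df k x = 0 -> `|Df k y| * G ^+ q <= 1)
  (crit_card : forall k, exists2 s : seq R,
     (forall x, I0 x -> Df k x = 0 -> x \in s) & (size s <= p)%N)
  (N_large : 2 * G < delta *+ N).

Let G0 : 0 < G. Proof. exact: lt_trans G1. Qed.
Let GX n : 0 < G ^+ n. Proof. exact: exprn_gt0. Qed.

Definition big_count c x : nat :=
  \sum_(1 <= j < c) (delta%:E <= rr I0 f Df j x)%E.

Lemma rr_ge0 j x : (0 <= rr I0 f Df j x)%E.
Proof. by rewrite le_min !len_ge0. Qed.

Lemma big_countS c x : (0 < c)%N ->
  big_count c.+1 x = (big_count c x + (delta%:E <= rr I0 f Df c x)%E)%N.
Proof. by move=> c0; rewrite /big_count big_nat_recr. Qed.

Lemma big_count_le c x : (big_count c x <= big_count c.+1 x)%N.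
Proof.
case: c => [|c]; first by rewrite /big_count big_geq.
by rewrite (@big_countS c.+1) // leq_addr.
Qed.

Let delta0 : 0 < delta. Proof. by rewrite divr_gt0. Qed.

(** Every counted time contributes at least [delta] and the other terms are nonnegative; a small
    average of the r_j thus allows few times with [r_j >= delta]. *)
Lemma big_count_sum c x :
  ((delta *+ big_count c x)%:E <= \sum_(1 <= j < c) rr I0 f Df j x)%E.
Proof.
elim: c => [|c IH]; first by rewrite /big_count !big_geq.
case: c IH => [|c] IH; first by rewrite /big_count !big_geq.
rewrite (@big_countS c.+1) // mulrnDr EFinD big_nat_recr //=; apply: leeD => //.
by case: (leP delta%:E) => [//|_]; exact: rr_ge0.
Qed.

(* [s], [k] and [b] count, along the first [i] times, the cuts made because the
   image of the piece had become longer than [eps], the cuts made at critical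
   points, and the cuts of the first kind made while [r_j >= delta]; [c] is [i]
   before the length cut of time [i] and [i.+1] after it. *)
Record piece (i c : nat) (K : set R) (s k b : nat) : Prop := Piece {
  piece_branch : branch I0 f Df i K;
  piece_bounded : forall x y, K x -> K y -> `|x - y| <= eps;
  piece_diam : forall x y, K x -> K y ->
    `|fiter f i x - fiter f i y| * G ^+ (M * s) <= eps * G ^+ i;
  piece_cuts : (M * s <= i + M)%N;
  piece_deriv : forall x, K x -> `|Dfiter f Df i x| * G ^+ (q * k) <= G ^+ i;
  piece_big : forall x, K x -> (b <= big_count c x)%N }.

Lemma branch_subset i K K' : branch I0 f Df i K -> K' `<=` K -> is_interval K' ->
  branch I0 f Df i K'.
Proof.
move=> [_ KI nc] sub iK'; split=> //; first exact: subset_trans KI.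
by move=> j ji z /sub; apply: nc.
Qed.

(** A critical cut shares the weight equally among at most [p + 1] pieces. A length cut gives 1/4 of
    it to each of the two short-sided pieces and 1/(4N) to each of the [N] others, 3/4 in total. *)
Definition weight (s k b : nat) : R :=
  4^-1 ^+ s * (p.+1%:R^-1) ^+ k * (N%:R^-1) ^+ b.

Lemma weight_ge0 s k b : 0 <= weight s k b.
Proof. by rewrite /weight !mulr_ge0 // exprn_ge0 // invr_ge0. Qed.

Let N0 : N%:R != 0 :> R.
Proof.
rewrite pnatr_eq0; apply/eqP => N0.
by move: N_large; rewrite N0 mulr0n ltNge mulr_ge0 // ltW.
Qed.

(** * One step of refinement: the length cut and the critical cut at time [i] *)

Section refinement.
Variables (E : set R) (C : R) (i : nat).
Hypotheses (C0 : 0 <= C)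
  (Enc : forall x, E x -> Df i (fiter f i x) != 0).

Lemma refine_critical K s k b : piece i i.+1 K s k b ->
  (forall x y, K x -> K y -> `|fiter f i x - fiter f i y| <= eps) ->
  (forall K' s' k' b', piece i.+1 i.+1 K' s' k' b' ->
     covered (K' `&` E) (C * weight s' k' b')) ->
  covered (K `&` E) (C * weight s k b).
Proof.
move=> [bK Kb Kd Ms KD Kc] Keps H.
have [iK KI nc] := bK.
have lip x y : I0 x -> I0 y -> `|f i x - f i y| <= G * `|x - y|.
  apply: (deriv_on_lipschitz itvI0 (@df i)); exact: DfG.
have diamS K' : K' `<=` K -> forall x y, K' x -> K' y ->
    `|fiter f i.+1 x - fiter f i.+1 y| * G ^+ (M * s) <= eps * G ^+ i.+1.
  move=> sub x y /sub Kx /sub Ky /=.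
  have L := lip _ _ (fiter_I0 fI0 i (KI _ Kx)) (fiter_I0 fI0 i (KI _ Ky)).
  rewrite exprS mulrCA; apply: (@le_trans _ _
    (G * `|fiter f i x - fiter f i y| * G ^+ (M * s))).
    by rewrite ler_wpM2r // ltW.
  by rewrite -mulrA ler_pM2l // Kd.
have branchS K' : K' `<=` K -> is_interval K' ->
    (forall z, K' z -> Df i (fiter f i z) != 0) -> branch I0 f Df i.+1 K'.
  move=> sub iK' nz; split=> //; first exact: subset_trans KI.
  move=> j; rewrite ltnS leq_eqVlt => /predU1P[->|ji] z Kz; first exact: nz.
  by apply: nc => //; exact: sub.
have MsS : (M * s <= i.+1 + M)%N by apply: leq_trans Ms _; lia.
have [[z [Kz Dz]]|noz] :=
  pselect (exists z, K z /\ Df i (fiter f i z) = 0); last first.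
  (* The image meets no critical point: [K] survives whole with the same counters, and the
     derivative grows by a factor at most [G]. *)
  apply: H; split => //.
  - by apply: branchS => // z Kz; apply/eqP => Dz; apply: noz; exists z.
  - exact: diamS.
  - move=> x Kx; rewrite DfiterS normrM mulrAC exprSr.
    rewrite ler_pM ?mulr_ge0 ?KD ?DfG //; first by rewrite ltW.
    exact/(fiter_I0 fI0)/KI.
have [cs csP cs_size] := crit_card i.
pose t := [seq c <- cs | Df i c == 0].
have tP x : I0 x -> Df i x = 0 -> x \in t.
  by move=> Ix Dx; rewrite mem_filter Dx eqxx csP.
have t_size : (size t <= p)%N.
  by rewrite (leq_trans _ cs_size) // size_filter count_size.
pose cnt x := count (fun c => c < fiter f i x)%R t.
(* The preimages of critical points are removed, and the pieces are indexed by the number of listed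
   critical points below f^i(x). *)
pose K_ j := K `&` [set x | Df i (fiter f i x) != 0 /\ cnt x = j].
(* f^i is monotone on [K], so between two points with the same count the count is constant, and a
   critical point met in between would make the two counts differ. *)
have iK_ j : is_interval (K_ j).
  move=> x y [Kx [Dx cx]] [Ky [Dy cy]] w xwy.
  have Kw := iK _ _ Kx Ky _ xwy; split => //=.
  move: xwy => /andP[]; rewrite le_eqVlt => /predU1P[<-//|xw].
  rewrite le_eqVlt => /predU1P[->//|wy].
  have Iw := fiter_I0 fI0 i (KI _ Kw).
  have [m|m] := branch_monotone itvI0 fI0 df cDf bK Kx Ky.
    have m1 := m _ _ (lexx _) xw (ltW wy); have m2 := m _ _ (ltW xw) wy (lexx _).
    split; last first.
      by apply/eqP; rewrite eqn_leq -{1}cy -{1}cx !count_lt_mono // ltW.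
    apply/eqP => /(tP _ Iw) wt.
    by have := count_lt_strict wt (ltW m1) m2; rewrite -/(cnt x) -/(cnt y) cx cy ltnn.
  have m1 := m _ _ (lexx _) xw (ltW wy); have m2 := m _ _ (ltW xw) wy (lexx _).
  split; last first.
    by apply/eqP; rewrite eqn_leq -{1}cx -{1}cy !count_lt_mono // ltW.
  apply/eqP => /(tP _ Iw) wt.
  by have := count_lt_strict wt (ltW m2) m1; rewrite -/(cnt x) -/(cnt y) cx cy ltnn.
have HK j : covered (K_ j `&` E) (C * weight s k.+1 b).
  have sub : K_ j `<=` K by move=> x [].
  apply: H; split => //.
  - by apply: branchS => // x [_ []].
  - by move=> x y /sub Kx /sub Ky; exact: Kb.
  - exact: diamS.
  - move=> x /sub Kx; rewrite DfiterS normrM mulnS exprD.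
    rewrite [G ^+ q * _]mulrC mulrACA exprSr.
    apply: ler_pM; rewrite ?mulr_ge0 ?KD //; try by rewrite ltW.
    (* The image has length at most [eps] and contains a critical point, so this factor of the
       derivative is at most [G^-q], which pays for the increase of [k]. *)
    apply: le_trans (ltW G1); apply: (crit_small _ _ (Keps _ _ Kz Kx) Dz);
      exact/(fiter_I0 fI0)/KI.
  - by move=> x /sub; exact: Kc.
have := @covered_bigcup _ p.+1 (fun j => K_ j `&` E) _ (fun j _ => HK j).
apply: covered_sub => [x [Kx Ex]|].
  exists (cnt x); first by rewrite ltnS (leq_trans _ t_size) // count_size.
  by split=> //; split => //; split => //; exact: Enc.
rewrite -mulrnAr ler_wpM2l // /weight exprS -[X in X <= _]mulr_natr.
rewrite le_eqVlt; apply/orP; left; apply/eqP; field.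
by rewrite addrC natr1 pnatr_eq0.
Qed.

Lemma refine_long K s k b : piece i i K s k b ->
  (forall K' s' k' b', piece i i.+1 K' s' k' b' ->
     (forall x y, K' x -> K' y -> `|fiter f i x - fiter f i y| <= eps) ->
     covered (K' `&` E) (C * weight s' k' b')) ->
  covered (K `&` E) (C * weight s k b).
Proof.
move=> [bK Kb Kd Ms KD Kc] H; have [iK KI nc] := bK.
have Kc' x : K x -> (b <= big_count i.+1 x)%N.
  by move=> /Kc /leq_trans; apply; exact: big_count_le.
have [Keps|] := pselect
    (forall x y, K x -> K y -> `|fiter f i x - fiter f i y| <= eps).
  by apply: H.
move=> /existsNP[x1 /existsNP[x2 /not_implyP[Kx1 /not_implyP[Kx2 /negP]]]].
rewrite -ltNge => long.
(* An image longer than [eps] is compatible with the diameter bound of a piece only if enough time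
   has passed since the earlier length cuts. *)
have Msi : (M * s < i)%N.
  rewrite -(ltr_eXn2l G1) -(ltr_pM2l eps0).
  by apply: lt_le_trans (Kd _ _ Kx1 Kx2); rewrite ltr_pM2r.
have i0 : (0 < i)%N by apply: leq_ltn_trans Msi.
have deltaM : delta * G ^+ M = eps by rewrite /delta divfK // lt0r_neq0.
have GM1 n : 1 <= G ^+ n by rewrite exprn_ege1 // ltW.
have delta_eps : delta <= eps by rewrite -deltaM ler_peMr // ltW.
have sub_piece K' b' : K' `<=` K -> is_interval K' ->
    (forall x y, K' x -> K' y -> `|fiter f i x - fiter f i y| <= delta) ->
    (forall x, K' x -> (b' <= big_count i.+1 x)%N) ->
    covered (K' `&` E) (C * weight s.+1 k b').
  move=> sub iK' K'd K'b; apply: H; last first.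
    by move=> x y Kx Ky; apply: le_trans delta_eps; exact: K'd.
  split => //.
  - exact: branch_subset bK sub iK'.
  - by move=> x y /sub Kx /sub Ky; exact: Kb.
  (* The new factor [G^M] is absorbed by the new length [delta = eps / G^M], the old one by
     [M * s < i]. *)
  - move=> x y Kx Ky; rewrite mulnS exprD mulrA.
    apply: ler_pM; rewrite ?mulr_ge0 //; try by rewrite ltW.
      by rewrite -deltaM ler_pM2r // K'd.
    exact: (ler_weXn2l (ltW G1) (ltnW Msi)).
  - by rewrite mulnS addnC leq_add2r ltnW.
  - by move=> x /sub; exact: KD.
have HL : covered (short_left I0 f Df i K delta `&` E) (C * weight s.+1 k b).
  apply: sub_piece; first by move=> x [].
  - exact: short_left_interval bK.
  - exact: short_left_diam bK.
  - by move=> x [/Kc'].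
have HR : covered (short_right I0 f Df i K delta `&` E) (C * weight s.+1 k b).
  apply: sub_piece; first by move=> x [].
  - exact: short_right_interval bK.
  - exact: short_right_diam bK.
  - by move=> x [/Kc'].
(* By [N_large], [N] consecutive segments of length [delta] cover [[-G, G]]; their preimages in a
   branch are intervals. *)
pose J j : set R := `[- G + delta *+ j, - G + delta *+ j.+1]%classic.
pose K_ j := long_sides I0 f Df i K delta `&` fiter f i @^-1` J j.
have HK j : covered (K_ j `&` E) (C * weight s.+1 k b.+1).
  have sub : K_ j `<=` K by move=> x [[]].
  have bl : branch I0 f Df i (long_sides I0 f Df i K delta).
    apply: (branch_subset bK); first by move=> x [].
    exact: long_sides_interval bK.
  apply: sub_piece => //.
  - apply: (branch_interval itvI0 fI0 df cDf bl); exact: interval_is_interval.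
  - move=> x y [_]; rewrite /J /= in_itv /= mulrSr => /andP[x1' x2'] [_].
    rewrite /J /= in_itv /= mulrSr => /andP[y1 y2].
    by rewrite ler_norml; apply/andP; split; lra.
  (* Here [r_i >= delta], so time [i] itself is counted and [b] may increase. *)
  - move=> x [[Kx /= lx] _]; rewrite big_countS // lx addn1 ltnS; exact: Kc.
(* [I0] may be unbounded; only from time 1 on are the values bounded by [G]. *)
have fiG x : K x -> `|fiter f i x| <= G.
  move=> Kx; rewrite -(prednK i0) /=; apply: fG; apply: fiter_I0 => //; exact: KI.
have := coveredU (coveredU HL HR)
  (@covered_bigcup _ N (fun j => K_ j `&` E) _ (fun j _ => HK j)).
apply: covered_sub => [x [Kx Ex]|].
  have [?|[?|lx]] := short_or_long I0 f Df i delta Kx.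
  - by left; left.
  - by left; right.
  right.
  have := fiG _ Kx; rewrite ler_norml => /andP[g1 g2].
  have fd0 : 0 <= (fiter f i x + G) / delta.
    by rewrite divr_ge0 ?(ltW delta0) // -lerBlDr sub0r.
  pose j := Num.truncn ((fiter f i x + G) / delta).
  have := truncn_itv fd0; rewrite -/j => /andP[].
  rewrite ler_pdivlMr // ltr_pdivrMr // !mulr_natl => j1 j2.
  exists j.
    rewrite -(ltr_nat R) -(ltr_pM2l delta0) !mulr_natr.
    apply: le_lt_trans N_large; apply: le_trans j1 _; lra.
  split => //; split => //; rewrite /J /= in_itv /=.
  by apply/andP; split; lra.
rewrite -mulrnAr -!mulrDr ler_wpM2l // -[X in _ + X]mulr_natr.
rewrite (_ : _ + _ = 3 / 4 * weight s k b); last first.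
  by rewrite /weight !exprS; field; rewrite N0.
by rewrite ler_piMl ?weight_ge0 //; lra.
Qed.

End refinement.

(** Induction on the remaining time [m]. The length cut precedes the critical cut, which relies on
    images of length at most [eps]. *)
Lemma covered_pieces (E : set R) (C : R) (n : nat) : 0 <= C ->
  (forall x, E x -> Dfiter f Df n x != 0) ->
  (forall K s k b, piece n n K s k b -> covered (K `&` E) (C * weight s k b)) ->
  forall m i K s k b, (i + m = n)%N -> piece i i K s k b ->
    covered (K `&` E) (C * weight s k b).
Proof.
move=> C0 Enz Hn; elim=> [|m IH] i K s k b.
  by rewrite addn0 => -> /Hn.
rewrite addnS -addSn => imn Kp.
have lin : (i < n)%N by rewrite -imn leq_addr.
apply: (refine_long C0 Kp) => K' s' k' b' K'p K'd.
apply: (refine_critical C0 _ K'p K'd) => [x Ex|K'' s'' k'' b''].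
  have /prodf_neq0/(_ (Ordinal lin) isT) := Enz _ Ex; exact.
exact: IH.
Qed.

(** * Measure of the set of points with large derivative and small average of r_i *)

Section exponential_growth.
Variables (lambda theta : R) (u : nat).
Hypotheses (lambda0 : 0 < lambda) (theta1 : 1 <= theta)
  (theta3 : theta ^+ 3 = expR lambda) (thetaM : 4 <= theta ^+ M)
  (thetaq : p.+1%:R <= theta ^+ q) (thetau : N%:R <= theta ^+ u)
  (u0 : (0 < u)%N).

Definition bad n : set R := [set x | [/\ I0 x,
  expR (2 * lambda) ^+ n <= `|Dfiter f Df n x| &
  (\sum_(1 <= j < n.+1) rr I0 f Df j x < (delta / u%:R * n%:R)%:E)%E]].

(** A derivative of modulus at least 1 turns [piece_deriv] into [G^(q k) <= G^n]; the small sum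
    bounds [b] through [big_count_sum]. *)
Lemma bad_cuts n K s k b x : piece n n K s k b -> K x -> bad n x ->
  [/\ (M * s <= n + M)%N, (q * k <= n)%N & (u * b <= n)%N].
Proof.
move=> [_ _ _ Ms KD Kb] Kx [Ix xD xr]; split => //.
  rewrite -(ler_eXn2l G1); apply: le_trans (KD _ Kx).
  rewrite ler_peMl ?(ltW (GX _)) //; apply: le_trans xD.
  by rewrite exprn_ege1 // -expR0 ler_expR mulr_ge0 // ltW.
have := le_lt_trans (big_count_sum n.+1 x) xr.
rewrite lte_fin -[delta *+ _]mulr_natr -mulrA ltr_pM2l // => bn.
rewrite -(ler_nat R) natrM mulrC -ler_pdivlMr ?ltr0n //.
rewrite mulrC; apply/ltW; apply: le_lt_trans bn; rewrite ler_nat.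
exact: leq_trans (Kb _ Kx) (big_count_le _ _).
Qed.

(** The inverses of the three factors of the weight are at most [theta^(n + M)], [theta^n] and
    [theta^n], with product [theta^M * e^(lambda n)]. *)
Lemma weight_lower n s k b : (M * s <= n + M)%N -> (q * k <= n)%N ->
  (u * b <= n)%N -> expR (- lambda) ^+ n <= theta ^+ M * weight s k b.
Proof.
move=> Ms qk ub.
have pow (y : R) (m e l : nat) : 0 < y -> y <= theta ^+ e -> (e * m <= l)%N ->
    y ^+ m <= theta ^+ l.
  move=> y0 ye em; apply: (@le_trans _ _ (theta ^+ (e * m))); last exact: ler_weXn2l.
  by rewrite exprM lerXn2r // nnegrE ?(ltW y0) // exprn_ge0 // (le_trans ler01).
have h1 := pow _ _ _ _ (ltr0n R 4) thetaM Ms.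
have h2 := pow _ _ _ _ (ltr0Sn R p) thetaq qk.
have Np : 0 < N%:R :> R by rewrite lt_neqAle eq_sym N0 ler0n.
have h3 := pow _ _ _ _ Np thetau ub.
have th0 l : 0 < theta ^+ l by rewrite exprn_gt0 // (lt_le_trans ltr01).
rewrite /weight !exprVn -!invfM ler_pdivlMr ?mulr_gt0 ?exprn_gt0 //.
rewrite expRN exprVn ler_pdivrMl ?exprn_gt0 ?expR_gt0 //.
rewrite -theta3 -exprM mulSn mulSn mulSn mul0n addn0 !exprD.
apply: (@le_trans _ _ (theta ^+ (n + M) * theta ^+ n * theta ^+ n)).
  by rewrite ler_pM ?mulr_ge0 ?exprn_ge0 // ler_pM ?exprn_ge0.
by rewrite exprD le_eqVlt; apply/orP; left; apply/eqP; ring.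
Qed.

(** The image has diameter at most [2 G], so the measure is at most [4 G e^(-2 lambda n)]; one
    factor [e^(-lambda n)] is traded for the weight by [weight_lower]. *)
Lemma covered_bad_piece n K s k b : piece n n K s k b ->
  covered (K `&` bad n)
    (4 * G * theta ^+ M * expR (- lambda) ^+ n * weight s k b).
Proof.
move=> Kp; have [bK Kb _ _ _ _] := Kp; have [iK KI _] := bK.
have tM0 : 0 <= theta ^+ M by rewrite exprn_ge0 // (le_trans ler01).
have e0 l : 0 < expR l :> R := expR_gt0 l.
have C0 : 0 <= 4 * G * theta ^+ M * expR (- lambda) ^+ n * weight s k b.
  by rewrite !mulr_ge0 ?weight_ge0 ?(ltW G0) // exprn_ge0 // ltW.
(* The counters are controlled only through a bad point of [K]; without one there is nothing to
   cover. *)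
have [[x [Kx Bx]]|noB] := pselect (exists x, K x /\ bad n x); last first.
  by apply: covered_sub C0 covered0 => x ?; apply: noB; exists x.
have [Ms qk ub] := bad_cuts Kp Kx Bx.
(* For [n = 0] no point is bad: the empty sum would have to be negative. *)
have n0 : (0 < n)%N.
  case: n Bx {Kp Kb iK C0 bK Ms qk ub KI} => // -[_ _].
  by rewrite big_geq // mulr0 ltxx.
have KG y z : K y -> K z -> `|fiter f n y - fiter f n z| <= 2 * G.
  have aux w : K w -> `|fiter f n w| <= G.
    by move=> Kw; rewrite -(prednK n0); apply: fG; apply: fiter_I0 => //; exact: KI.
  move=> /aux Ky /aux Kz; apply: le_trans (ler_normB _ _) _; lra.
have D0 : 0 < expR (2 * lambda) ^+ n by rewrite exprn_gt0.
have G20 : 0 < 2 * G by rewrite mulr_gt0.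
have := covered_large_deriv itvI0 (@fiter_deriv _ _ _ _ fI0 df n)
  (@Dfiter_cont _ _ _ _ fI0 df cDf n) iK KI Kb
  (fun x => @branch_Dfiter _ _ _ _ _ _ x bK) G20 KG D0.
apply: covered_sub => [y [Ky [_ yD _]]|]; first by split.
have -> : expR (2 * lambda) ^+ n = (expR lambda ^+ n) * (expR lambda ^+ n).
  by rewrite -exprMn -expRD; congr (expR _ ^+ _); ring.
rewrite invfM -!exprVn -expRN mulrA.
set r := expR (- lambda) ^+ n.
have r0 : 0 <= r by rewrite exprn_ge0 // ltW.
have -> : 4 * G * theta ^+ M * r * weight s k b =
  2 * (2 * G) * r * (theta ^+ M * weight s k b) by ring.
rewrite (_ : 2 * 2 * G * (r * r) = 2 * (2 * G) * r * r); last by ring.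
apply: ler_wpM2l; last exact: weight_lower.
by rewrite !mulr_ge0 // ltW.
Qed.

Lemma covered_bad n K : is_interval K -> K `<=` I0 ->
  (forall x y, K x -> K y -> `|x - y| <= eps) ->
  covered (K `&` bad n) (4 * G * theta ^+ M * expR (- lambda) ^+ n).
Proof.
move=> iK KI Kd.
have tM0 : 0 <= theta ^+ M by rewrite exprn_ge0 // (le_trans ler01).
have -> : 4 * G * theta ^+ M * expR (- lambda) ^+ n =
    4 * G * theta ^+ M * expR (- lambda) ^+ n * weight 0 0 0.
  by rewrite /weight !expr0 !mulr1.
apply: (@covered_pieces (bad n) _ n _ _ _ n 0%N) => //.
- by rewrite !mulr_ge0 ?(ltW G0) // exprn_ge0 // expR_ge0.
- move=> x [_ + _]; rewrite -normr_gt0; apply: lt_le_trans.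
  by rewrite exprn_gt0 ?expR_gt0.
- by move=> ? ? ? ?; exact: covered_bad_piece.
split => //.
- by move=> x y Kx Ky; rewrite muln0 !expr0 !mulr1 Kd.
- by rewrite muln0.
- by move=> x _; rewrite muln0 /Dfiter big_ord0 normr1 mulr1.
Qed.

End exponential_growth.

End pieces.

(** * Conclusion *)

Section limn_einf_bounds.
Context {R : realType}.
Implicit Types (u : (\bar R)^nat) (a : \bar R).

Lemma limn_einfE u : limn_einf u = ereal_sup (range (einfs u)).
Proof. by rewrite limn_einf_lim; apply/cvg_lim => //; exact: cvg_einfs_sup. Qed.

Lemma limn_einf_gt u a : (a < limn_einf u)%E ->
  exists n0, forall n, (n0 <= n)%N -> (a < u n)%E.
Proof.
rewrite limn_einfE => /ereal_sup_gt[_ [n0 _ <-] an0]; exists n0 => n n0n.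
by apply: lt_le_trans an0 _; apply: ereal_inf_lbound; exists n.
Qed.

Lemma limn_einf_ge u a n0 : (forall n, (n0 <= n)%N -> (a <= u n)%E) ->
  (a <= limn_einf u)%E.
Proof.
move=> H; rewrite limn_einfE; apply: (@le_trans _ _ (einfs u n0)).
  by apply: le_ereal_inf_tmp => _ [n /= n0n <-]; exact: H.
by apply: ereal_sup_ubound; exists n0.
Qed.

End limn_einf_bounds.

Lemma exists_exp_ge {R : realType} (x t : R) : 0 < t ->
  exists2 n, (0 < n)%N & x <= expR t ^+ n.
Proof.
move=> t0; exists (Num.truncn (x / t)).+1 => //.
rewrite -expRM_natl; apply: le_trans (expR_ge1Dx _).
apply: ler_wpDl => //; rewrite -ler_pdivrMr //.
exact/ltW/truncnS_gt.
Qed.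

Lemma nat_grid {R : realType} (x e : R) : 0 < e -> exists j : nat,
  (e *+ j <= x <= e *+ j.+1) \/ (e *+ j <= - x <= e *+ j.+1).
Proof.
move=> e0.
have aux y : 0 <= y -> exists j : nat, e *+ j <= y <= e *+ j.+1.
  move=> y0; exists (Num.truncn (y / e)).
  have := truncn_itv (divr_ge0 y0 (ltW e0)).
  rewrite ler_pdivlMr // ltr_pdivrMr // !mulr_natl => /andP[-> /ltW].
  by move=> ->.
have [x0|x0] := leP 0 x; first by have [j] := aux x x0; exists j; left.
by have [|j] := aux (- x); [rewrite oppr_ge0 ltW|exists j; right].
Qed.

Theorem theoremB (R : realType) (I0 : set R) (f Df : nat -> R -> R)
  (H : set R) (lambda : R) :
  is_interval I0 ->
  (forall k, C1_map I0 (f k) (Df k)) ->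
  C1_equicont I0 f Df ->
  C1_bounded I0 f Df ->
  (exists p : nat, forall k, exists2 s : seq R,
      crit I0 Df k `<=` [set` s] & (size s <= p)%N) ->
  0 < lambda ->
  H `<=` I0 ->
  (forall x, H x ->
     ((2 * lambda)%:E <
       limn_einf (fun n => (ln `|Dfiter f Df n x| / n%:R)%:E))%E) ->
  exists2 c : R, 0 < c &
    {ae (@lebesgue_measure R), forall x, H x ->
       (c%:E <= limn_einf (fun n =>
         (n%:R^-1)%:E * \sum_(1 <= i < n.+1) rr I0 f Df i x))%E}.
Proof.
move=> iI C1 equi [G' G'0 bounded] [p crit_card] l0 HI Hexp.
have fI k x : I0 x -> I0 (f k x) by case: (C1 k) => h _ _; exact: h.
have df k : deriv_on I0 (f k) (Df k).
  by case: (C1 k) => _ h _; exact: deriv_on_has_deriv.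
have cDf k : cont_on I0 (Df k).
  by case: (C1 k) => _ _ h; exact: within_cont_on.
(* A bound above 1 makes powers of [G] comparable through their exponents. *)
pose G := G' + 1.
have G1 : 1 < G by rewrite ltrDr.
have G'G : G' <= G by rewrite lerDl.
have fG k x : I0 x -> `|f k x| <= G.
  by move=> /(bounded k)[h _]; exact: le_trans G'G.
have DfG k x : I0 x -> `|Df k x| <= G.
  by move=> /(bounded k)[_ h]; exact: le_trans G'G.
have GX n : 0 < G ^+ n by rewrite exprn_gt0 // (lt_trans ltr01).
have l3 : 0 < lambda / 3 by rewrite divr_gt0.
pose theta := expR (lambda / 3).
have theta1 : 1 <= theta by rewrite -expR0 ler_expR ltW.
have theta3 : theta ^+ 3 = expR lambda.
  by rewrite -expRM_natl; congr expR; field.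
(* The order of choice matters: [q] and [M] depend on [lambda] and [p] only, [eps] on [q], [delta]
   on [eps] and [M], [N] on [delta], and [u] on [N]. *)
have [q _ thetaq] := exists_exp_ge p.+1%:R l3.
have [M _ thetaM] := exists_exp_ge 4 l3.
have [eps' eps'0 small] := equi (G ^+ q)^-1 ltac:(by rewrite invr_gt0).
(* Equicontinuity needs a strict inequality, whereas pieces and images may have length exactly
   [eps]. *)
pose eps := eps' / 2.
have eps0 : 0 < eps by rewrite divr_gt0.
have crit_small k x y : I0 x -> I0 y -> `|x - y| <= eps ->
    Df k x = 0 -> `|Df k y| * G ^+ q <= 1.
  move=> Ix Iy xy Dx; have [|_] := small x y Ix Iy _ k.
    by apply: le_lt_trans xy _; rewrite /eps; lra.
  by rewrite Dx sub0r normrN -ler_pdivlMr // div1r => /ltW.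
have crit_card' k : exists2 s : seq R,
    (forall x, I0 x -> Df k x = 0 -> x \in s) & (size s <= p)%N.
  by have [s sk sp] := crit_card k; exists s => // x Ix Dx; apply: sk.
pose delta := eps / G ^+ M.
have delta0 : 0 < delta by rewrite divr_gt0.
pose N := (Num.truncn (2 * G / delta)).+1.
have N_large : 2 * G < delta *+ N.
  by rewrite -[ltRHS]mulr_natl -ltr_pdivrMr // truncnS_gt.
have [u u0 thetau] := exists_exp_ge N%:R l3.
pose c := delta / u%:R.
have c0 : 0 < c by rewrite divr_gt0 // ltr0n.
exists c => //.
pose B := bad I0 f Df G eps M lambda u.
have rho01 : 0 <= expR (- lambda) < 1.
  by rewrite expR_ge0 expR_lt1 oppr_lt0.
(* The refinement starts from short intervals, so the line is covered by countably many grid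
   segments of length [eps], each with its own null set. *)
have ae_piece K : is_interval K -> (forall x y, K x -> K y -> `|x - y| <= eps) ->
    {ae (@lebesgue_measure R), forall x, exists n0, forall n, (n0 <= n)%N ->
      ~ ((I0 `&` K) `&` B n) x}.
  move=> iK Kd; apply: (ae_eventually_notin rho01) => n.
  apply: (covered_bad iI fI df cDf G1 eps0 fG DfG crit_small crit_card' N_large
    l0 theta1 theta3 thetaM thetaq thetau u0).
  - by move=> x y [Ix Kx] [Iy Ky] z xzy; split; [exact: iI xzy|exact: iK xzy].
  - by move=> x [].
  - by move=> x y [_ Kx] [_ Ky]; exact: Kd.
have grid_diam (a : R) j x y : a = eps *+ j -> a <= x <= eps *+ j.+1 ->
    a <= y <= eps *+ j.+1 -> `|x - y| <= eps.
  move=> ->; rewrite mulrSr => /andP[? ?] /andP[? ?].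
  by rewrite ler_norml; apply/andP; split; lra.
have ae1 j : {ae (@lebesgue_measure R), forall x, exists n0,
    forall n, (n0 <= n)%N ->
      ~ ((I0 `&` [set x | eps *+ j <= x <= eps *+ j.+1]) `&` B n) x}.
  apply: ae_piece => [x y /= /andP[? ?] /andP[? ?] z /andP[? ?]|x y /=].
    by apply/andP; split; lra.
  exact: grid_diam.
have ae2 j : {ae (@lebesgue_measure R), forall x, exists n0,
    forall n, (n0 <= n)%N ->
      ~ ((I0 `&` [set x | eps *+ j <= - x <= eps *+ j.+1]) `&` B n) x}.
  apply: ae_piece => [x y /= /andP[? ?] /andP[? ?] z /andP[? ?]|x y /= h1 h2].
    by apply/andP; split; lra.
  by have := grid_diam _ j _ _ erefl h1 h2; rewrite -opprD normrN.
apply: (filterS _ (filterI (ae_foralln ae1) (ae_foralln ae2))) => x.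
move=> [h1 h2] Hx; have Ix := HI _ Hx.
have [n1 Hn1] : exists n0, forall n, (n0 <= n)%N -> ~ B n x.
  have [j [xj|xj]] := nat_grid x eps0.
    by have [n0 h] := h1 j; exists n0 => n /h h' Bx; apply: h'.
  by have [n0 h] := h2 j; exists n0 => n /h h' Bx; apply: h'.
have [n2 Hn2] := limn_einf_gt (Hexp x Hx).
apply: (@limn_einf_ge _ _ _ (maxn n1 n2)) => n.
rewrite geq_max => /andP[/Hn1 nB /Hn2]; rewrite lte_fin => ln_gt.
(* At [n = 0] the quotient is 0, since the inverse of 0 is 0, and cannot exceed [2 * lambda]. *)
have n0 : (0 < n)%N.
  case: n ln_gt {nB} => //; rewrite invr0 mulr0 ltNge mulr_ge0 //.
  exact: ltW.
have nR : 0 < n%:R :> R by rewrite ltr0n.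
move: ln_gt; rewrite ltr_pdivlMr // => ln_gt.
(* [ln] takes the value 0 at 0, so a large logarithm excludes a vanishing derivative. *)
have D0 : 0 < `|Dfiter f Df n x|.
  rewrite ltNge; apply/negP => /ln0 E; move: ln_gt.
  by rewrite E ltNge !mulr_ge0 // ltW.
have D_large : expR (2 * lambda) ^+ n <= `|Dfiter f Df n x|.
  by rewrite -expRM_natl -[leRHS]lnK // ler_expR mulrC ltW.
have [sum_ge|sum_lt] := leP (c * n%:R)%:E (\sum_(1 <= i < n.+1) rr I0 f Df i x)%E.
  by rewrite muleC lee_pdivlMr // -EFinM.
by case: nB.
Qed.
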